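(* Let $f,g:\mathbb{R}^n\to(-\infty,+\infty]$ be proper, lower semicontinuous and level-coercive with $\operatorname{dom}f\cap\operatorname{dom}g\neq\varnothing$, let $\alpha\in[0,1]$, and for $\mu>0$ let $\varphi^{\alpha}_{\mu}=-e_{\mu}(-\alpha e_{\mu}f-(1-\alpha)e_{\mu}g)$. Then $$\lim_{\mu\downarrow0}\inf\varphi^{\alpha}_{\mu}=\inf(\alpha f+(1-\alpha)g),\qquad \limsup_{\mu\downarrow0}\operatorname{argmin}\varphi^{\alpha}_{\mu}\subseteq\operatorname{argmin}(\alpha f+(1-\alpha)g).$$ Moreover, $(\operatorname{argmin}\varphi^{\alpha}_{\mu})_{\mu>0}$ lies in a bounded set.
   Context: $\|\cdot\|$ is the Euclidean norm; $\inf$ and $\operatorname{argmin}$ are over $\mathbb{R}^n$; the convention $0\cdot(+\infty)=0$ is used when $\alpha\in\{0,1\}$. $f$ is level-coercive if $\liminf_{\|x\|\to\infty}f(x)/\|x\|>0$. For a proper function $f$ and $\mu>0$, $e_{\mu}f(x)=\inf_{w}\{f(w)+\frac{1}{2\mu}\|w-x\|^2\}$. (Level-coercive proper lsc functions are bounded below, so every $\mu>0$ is admissible.) $\limsup_{\mu\downarrow0}S_\mu$ is the Painlevé--Kuratowski outer limit: the set of all cluster points of sequences $x_k\in S_{\mu_k}$ with $\mu_k\downarrow0$. *)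

(* Defs.v *)
From HB Require Import structures.
From mathcomp Require Import all_boot all_order all_algebra.
From mathcomp Require Import all_classical all_reals all_analysis.

Set Implicit Arguments.
Unset Strict Implicit.
Unset Printing Implicit Defensive.

Import Order.TTheory GRing.Theory Num.Theory numFieldNormedType.Exports.

Local Open Scope classical_set_scope.
Local Open Scope ring_scope.

(* The library norm on 'rV[R]_n is the sup norm; the topology is the same. *)
Definition enorm (R : realType) (n : nat) (x : 'rV[R]_n) : R :=
  Num.sqrt (\sum_(i < n) x 0 i ^+ 2).

Definition eff_dom (R : realType) (n : nat) (f : 'rV[R]_n -> \bar R)
    : set 'rV[R]_n :=
  [set x | (f x < +oo)%E].

Definition proper_fun (R : realType) (n : nat) (f : 'rV[R]_n -> \bar R)
    : Prop :=
  (forall x, f x != -oo%E) /\ eff_dom f !=set0.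

(* The filter ||x|| -> +oo. *)
Definition enorm_infty (R : realType) (n : nat) : set_system 'rV[R]_n :=
  filter_from setT (fun M : R => [set x | M < enorm x]).
Arguments enorm_infty : clear implicits.

Definition level_coercive (R : realType) (n : nat) (f : 'rV[R]_n -> \bar R)
    : Prop :=
  (0 < limf_einf (fun x => f x * ((enorm x)^-1)%:E) (enorm_infty R n))%E.

Definition inff (R : realType) (n : nat) (f : 'rV[R]_n -> \bar R) : \bar R :=
  ereal_inf (range f).

Definition argmin (R : realType) (n : nat) (f : 'rV[R]_n -> \bar R)
    : set 'rV[R]_n :=
  [set x | f x = inff f].

Definition moreau_env (R : realType) (n : nat) (mu : R)
    (f : 'rV[R]_n -> \bar R) (x : 'rV[R]_n) : \bar R :=
  inff (fun w => f w + ((2 * mu)^-1 * enorm (w - x) ^+ 2)%:E)%E.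

(* In \bar R, 0 * +oo = 0, which is the convention needed for a = 0 or 1. *)
Definition convex_comb (R : realType) (n : nat) (a : R)
    (f g : 'rV[R]_n -> \bar R) (x : 'rV[R]_n) : \bar R :=
  (a%:E * f x + (1 - a)%:E * g x)%E.

Definition phi (R : realType) (n : nat) (a : R) (f g : 'rV[R]_n -> \bar R)
    (mu : R) (x : 'rV[R]_n) : \bar R :=
  (- moreau_env mu (fun z => - (a%:E * moreau_env mu f z)
                             - (1 - a)%:E * moreau_env mu g z) x)%E.

(* The Painleve-Kuratowski outer limit of S_mu as mu decreases to 0. *)
Definition outer_limit (R : realType) (n : nat) (S : R -> set 'rV[R]_n)
    : set 'rV[R]_n :=
  [set x | exists (mu_ : nat -> R) (x_ : nat -> 'rV[R]_n),
     [/\ mu_ @ \oo --> 0^'+, forall k, 0 < mu_ k,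
         forall k, S (mu_ k) (x_ k) & cluster (x_ @ \oo) x]].

(* Main.v *)
(* The proof rests on two bounds for [phi].  First, taking [w = x] in the
   supremum and using [e_mu f(w) <= f(x) + |w - x|^2 / (2 mu)] gives
   [a e_mu f + (1 - a) e_mu g <= phi <= a f + (1 - a) g].  Second, [f] and [g]
   have a common convex minorant [l = c |.| - b] with [c > 0]; since [phi] is
   monotone in [f] and [g] and [-e_mu (-e_mu l) = l], we get [l <= phi] for
   every [mu > 0].  The second bound confines the minimisers, uniformly in [mu].
   Lower semicontinuity gives [e_mu f >= r] near [x] for all small [mu] whenever
   [r < f(x)], hence the same for [phi] by the first bound; compactness of a
   ball then yields convergence of the infima, and evaluating at cluster points
   yields the outer limit inclusion. *)
Require Import Defs.
From HB Require Import structures.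
From mathcomp Require Import all_boot all_order all_algebra.
From mathcomp Require Import all_classical all_reals all_analysis.
From mathcomp Require Import ring lra.
Import Order.TTheory GRing.Theory Num.Theory numFieldNormedType.Exports.
Local Open Scope classical_set_scope.
Local Open Scope ring_scope.

Set Implicit Arguments.
Unset Strict Implicit.
Unset Printing Implicit Defensive.

(** * The Euclidean norm *)

Lemma enorm_ge0 (R : realType) (n : nat) (x : 'rV[R]_n) : 0 <= enorm x.
Proof. exact: sqrtr_ge0. Qed.

Lemma sqr_enorm (R : realType) (n : nat) (x : 'rV[R]_n) :
  enorm x ^+ 2 = \sum_(i < n) x 0 i ^+ 2.
Proof. by rewrite sqr_sqrtr// sumr_ge0// => i _; exact: sqr_ge0. Qed.

Lemma enormB (R : realType) (n : nat) (x y : 'rV[R]_n) :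
  enorm (x - y) = enorm (y - x).
Proof.
by rewrite /enorm; congr Num.sqrt; apply: eq_bigr => i _; rewrite !mxE; ring.
Qed.

Lemma ler_coord_enorm (R : realType) (n : nat) (x : 'rV[R]_n) (i : 'I_n) :
  `|x 0 i| <= enorm x.
Proof.
rewrite -(ger0_norm (enorm_ge0 x)) -ler_sqr ?nnegrE// !real_normK ?num_real//.
by rewrite sqr_enorm (bigD1 i)//= lerDl sumr_ge0// => j _; exact: sqr_ge0.
Qed.

(** Cauchy-Schwarz, by expanding the nonnegative sum of squares of [y - |y| u]; the final division
    by [|y|] makes [y = 0] a separate case. *)
Lemma dot_le_enorm (R : realType) (n : nat) (y u : 'rV[R]_n) :
  enorm u <= 1 -> \sum_(i < n) y 0 i * u 0 i <= enorm y.
Proof.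
move=> u1; set d := (X in X <= _).
have yE := sqr_enorm y; have uE := sqr_enorm u.
have : 0 <= \sum_(i < n) (y 0 i - enorm y * u 0 i) ^+ 2.
  by apply: sumr_ge0 => i _; exact: sqr_ge0.
have -> : \sum_(i < n) (y 0 i - enorm y * u 0 i) ^+ 2 =
    enorm y ^+ 2 - 2 * enorm y * d + enorm y ^+ 2 * enorm u ^+ 2.
  rewrite {1}yE uE /d !mulr_sumr -sumrB -big_split/=.
  by apply: eq_bigr => i _; ring.
have := enorm_ge0 u; have := enorm_ge0 y.
rewrite le_eqVlt => /predU1P[y0 _ _|y0 u0 H]; last first.
  have yu : enorm y ^+ 2 * enorm u ^+ 2 <= enorm y ^+ 2.
    by rewrite ler_piMr ?sqr_ge0// expr_le1.
  by rewrite -(ler_pM2l y0) -expr2; lra.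
rewrite /d big1 -?y0// => i _.
have := ler_coord_enorm y i; rewrite -y0 normr_le0 => /eqP ->.
by rewrite mul0r.
Qed.

(* The point [w] is where the proximal map of [mu c |.|] returns [x]: it
   follows from a subgradient [c u] of [c |.|] at [x]. *)
Lemma enorm_prox_point (R : realType) (n : nat) (c mu : R) (x : 'rV[R]_n) :
  0 <= c -> 0 < mu -> exists w : 'rV[R]_n, forall y : 'rV[R]_n,
    c * enorm x + (2 * mu)^-1 * enorm (w - x) ^+ 2
      <= c * enorm y + (2 * mu)^-1 * enorm (y - w) ^+ 2.
Proof.
(* Since the inverse of [0] is [0], [u = 0] when [x = 0], which is still a subgradient of the norm
   there. *)
move=> c0 mu0; pose u := (enorm x)^-1 *: x.
have x0 := enorm_ge0 x.
have xu : \sum_(i < n) x 0 i * u 0 i = enorm x.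
  rewrite (eq_bigr (fun i => (enorm x)^-1 * x 0 i ^+ 2)); last first.
    by move=> i _; rewrite mxE; ring.
  rewrite -mulr_sumr -sqr_enorm expr2 mulrA.
  by have [->|x1] := eqVneq (enorm x) 0; rewrite ?mulr0// mulVf// mul1r.
have u1 : enorm u <= 1.
  rewrite -ler_sqr ?nnegrE ?enorm_ge0// sqr_enorm expr1n.
  rewrite (eq_bigr (fun i => (enorm x)^-1 * (x 0 i * u 0 i))); last first.
    by move=> i _; rewrite mxE; ring.
  rewrite -mulr_sumr xu.
  by have [->|x1] := eqVneq (enorm x) 0; rewrite ?mulr0// mulVf.
exists (x + (mu * c) *: u) => y.
have yu := dot_le_enorm y u1.
have -> : enorm (y - (x + (mu * c) *: u)) ^+ 2 = enorm (y - x) ^+ 2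
    - 2 * mu * c * (\sum_(i < n) y 0 i * u 0 i - enorm x)
    + enorm (x + (mu * c) *: u - x) ^+ 2.
  rewrite -xu !sqr_enorm -sumrB mulr_sumr -sumrB -big_split/=.
  by apply: eq_bigr => i _; rewrite !mxE; ring.
rewrite -lerBlDr -addrA -mulrBr.
set d := \sum_(i < n) _ in yu *; set p := enorm (y - x).
have -> : (2 * mu)^-1 * (enorm (x + (mu * c) *: u - x) ^+ 2
   - (p ^+ 2 - 2 * mu * c * (d - enorm x)
      + enorm (x + (mu * c) *: u - x) ^+ 2))
   = c * (d - enorm x) - (2 * mu)^-1 * p ^+ 2.
  by field; rewrite gt_eqF.
have : 0 <= (2 * mu)^-1 * p ^+ 2.
  by rewrite mulr_ge0 ?sqr_ge0// invr_ge0 mulr_ge0// ltW.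
nra.
Qed.

(** * Moreau envelopes and global bounds for [phi] *)

Lemma moreau_env_le (R : realType) (n : nat) (mu : R) (f : 'rV[R]_n -> \bar R)
    (x w : 'rV[R]_n) :
  (moreau_env mu f x <= f w + ((2 * mu)^-1 * enorm (w - x) ^+ 2)%:E)%E.
Proof. by apply: ereal_inf_lbound; exists w. Qed.

Lemma le_moreau_env (R : realType) (n : nat) (mu : R)
    (f : 'rV[R]_n -> \bar R) (x : 'rV[R]_n) (r : \bar R) :
  (forall w, r <= f w + ((2 * mu)^-1 * enorm (w - x) ^+ 2)%:E)%E ->
  (r <= moreau_env mu f x)%E.
Proof. by move=> H; apply: le_ereal_inf_tmp => _ [w _ <-]; exact: H. Qed.

(** Finiteness is what lets the opposite be distributed over the sum inside [phi]. *)
Lemma moreau_env_fin_num (R : realType) (n : nat) (mu b : R)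
    (f : 'rV[R]_n -> \bar R) (x : 'rV[R]_n) :
  0 < mu -> eff_dom f !=set0 -> (forall w, b%:E <= f w)%E ->
  moreau_env mu f x \is a fin_num.
Proof.
move=> mu0 [y fy] fb; rewrite fin_numElt; apply/andP; split.
  apply: (@lt_le_trans _ _ b%:E); first exact: ltNyr.
  apply: le_moreau_env => w; rewrite -[leLHS]adde0; apply: leeD => //.
  by rewrite lee_fin mulr_ge0 ?sqr_ge0// invr_ge0 mulr_ge0// ltW.
apply: (le_lt_trans (moreau_env_le _ _ _ y)).
by rewrite lte_add_pinfty// ltry.
Qed.

(** The test point [w] is kept free: [w = x] kills the penalty, and the proximal point serves the
    convex minorant. *)
Lemma phi_ge (R : realType) (n : nat) (a : R) (f g : 'rV[R]_n -> \bar R)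
    (mu A B : R) (x w : 'rV[R]_n) :
  0 <= a -> a <= 1 ->
  (A%:E <= moreau_env mu f w)%E -> (B%:E <= moreau_env mu g w)%E ->
  ((a * A + (1 - a) * B - (2 * mu)^-1 * enorm (w - x) ^+ 2)%:E
    <= phi a f g mu x)%E.
Proof.
move=> a0 a1 fA gB; rewrite leeNr; apply: le_trans (moreau_env_le _ _ _ w) _.
have -> : (- (a * A + (1 - a) * B - (2 * mu)^-1 * enorm (w - x) ^+ 2)%:E
  = - (a%:E * A%:E) - (1 - a)%:E * B%:E
    + ((2 * mu)^-1 * enorm (w - x) ^+ 2)%:E)%E.
  by rewrite -!EFinM -!EFinN -!EFinD; congr EFin; ring.
apply: leeD => //; apply: leeB; rewrite ?leeN2; apply: lee_wpmul2l => //.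
by rewrite lee_fin subr_ge0.
Qed.

Lemma phi_le (R : realType) (n : nat) (a : R) (f g : 'rV[R]_n -> \bar R)
    (mu b : R) (x : 'rV[R]_n) :
  0 <= a -> a <= 1 -> 0 < mu -> eff_dom f !=set0 -> eff_dom g !=set0 ->
  (forall w, b%:E <= f w)%E -> (forall w, b%:E <= g w)%E ->
  (phi a f g mu x <= convex_comb a f g x)%E.
Proof.
move=> a0 a1 mu0 f0 g0 fb gb; rewrite leeNl; apply: le_moreau_env => w.
have Ef := moreau_env_fin_num w mu0 f0 fb.
have Eg := moreau_env_fin_num w mu0 g0 gb.
rewrite -oppeD; last by rewrite fin_num_adde_defr// fin_numM.
rewrite leeNl [leLHS]oppeD ?fin_num_adde_defl// oppeK leeBlDr//.
set q := (_ * _)%:E.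
(* The weights sum to [1], so the penalty [q] can be shared between the two terms. *)
have -> : (convex_comb a f g x + q =
    (a%:E * (f x + q)) + (1 - a)%:E * (g x + q))%E.
  rewrite !muleDr ?fin_num_adde_defl// addeACA -!EFinM -EFinD.
  by congr (_ + _%:E)%E; ring.
by apply: leeD; apply: lee_wpmul2l; rewrite ?lee_fin ?subr_ge0//;
  rewrite /q enormB; exact: moreau_env_le.
Qed.

Lemma phi_ge_minorant (R : realType) (n : nat) (a : R)
    (f g : 'rV[R]_n -> \bar R) (mu b c : R) (x : 'rV[R]_n) :
  0 <= a -> a <= 1 -> 0 < mu -> 0 <= c ->
  (forall w, (c * enorm w - b)%:E <= f w)%E ->
  (forall w, (c * enorm w - b)%:E <= g w)%E ->
  ((c * enorm x - b)%:E <= phi a f g mu x)%E.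
Proof.
move=> a0 a1 mu0 c0 fc gc; have [w wP] := enorm_prox_point x c0 mu0.
(* By [wP], [r] bounds both envelopes at [w] from below; its penalty term then cancels the one
   subtracted in [phi_ge]. *)
pose r := c * enorm x - b + (2 * mu)^-1 * enorm (w - x) ^+ 2.
have rE (h : 'rV[R]_n -> \bar R) : (forall y, (c * enorm y - b)%:E <= h y)%E ->
    (r%:E <= moreau_env mu h w)%E.
  move=> hc; apply: le_moreau_env => y; apply: le_trans (leeD2r _ (hc y)).
  by rewrite -EFinD lee_fin /r; have := wP y; lra.
apply: le_trans (phi_ge x a0 a1 (rE _ fc) (rE _ gc)).
by rewrite lee_fin /r; lra.
Qed.

(** * Compactness and coercive minorants *)

Lemma enorm_ball_compact (R : realType) (n : nat) (M : R) :
  exists2 K : set 'rV[R]_n, compact K & [set x | enorm x <= M] `<=` K.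
Proof.
exists [set v : 'rV[R]_n | forall i, `[- M, M]%classic (v ord0 i)].
  apply: (@rV_compact R n (fun=> `[- M, M]%classic)) => _.
  exact: segment_compact.
move=> x /= xM i; rewrite in_itv/= -ler_norml.
exact: le_trans (ler_coord_enorm x i) xM.
Qed.

Lemma exists_EFin_lt (R : realType) (x : \bar R) :
  x != -oo%E -> exists r : R, (r%:E < x)%E.
Proof.
case: x => [r _|_|//]; last by exists 0; exact: ltry.
by exists (r - 1); rewrite lte_fin; lra.
Qed.

(** Lower semicontinuity bounds [f] below near each point; the covering form of compactness, with
    [b] tending to [+oo], makes the bound uniform. *)
Lemma lsc_compact_lower_bound (R : realType) (T : topologicalType)
    (f : T -> \bar R) (K : set T) :
  compact K -> lower_semicontinuous f -> (forall x, f x != -oo%E) ->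
  exists b : R, forall x, K x -> ((- b)%:E <= f x)%E.
Proof.
move=> /compact_near_coveringP cK f_lsc fNy.
have : \forall b \near +oo, K `<=` [set x | ((- b)%:E <= f x)%E].
  apply: cK => x Kx; have [r rf] := exists_EFin_lt (fNy x).
  have [V Vx Vf] := f_lsc _ _ rf.
  near=> y b; apply: le_trans (ltW (Vf y _)); last by near: y.
  rewrite lee_fin lerNl/=; near: b; apply: nbhs_pinfty_ge; exact: num_real.
by move=> /filter_ex[b bK]; exists b => x /bK.
Unshelve. all: by end_near. Qed.

Lemma level_coercive_minorant (R : realType) (n : nat)
    (f : 'rV[R]_n -> \bar R) :
  proper_fun f -> lower_semicontinuous f -> level_coercive f ->
  exists c b : R, 0 < c /\ forall x, ((c * enorm x - b)%:E <= f x)%E.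
Proof.
move=> [fNy _] f_lsc; rewrite /level_coercive /limf_einf oppe_gt0.
(* The lower limit is the opposite of an infimum, over neighbourhoods of infinity, of suprema of the
   negated quotient; some such supremum is negative. *)
move=> /ereal_inf_lt[_ [V [M _ MV] <-] s0].
have [c c0 sc] : exists2 c : R, 0 < c &
    (ereal_sup [set - (f x * ((enorm x)^-1)%:E) | x in V] <= (- c)%:E)%E.
  (* If the supremum is [-oo], any slope works, for instance [1]. *)
  move: s0; case: ereal_sup => [s|//|_]; last by exists 1; rewrite ?leNye.
  by rewrite lte_fin => s0; exists (- s); rewrite ?opprK// oppr_gt0.
pose M' := Num.max M 0.
have M'0 : 0 <= M' by rewrite le_max lexx orbT.
have [K cK MK] := enorm_ball_compact n M'.
have [b Kb] := lsc_compact_lower_bound cK f_lsc fNy.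
pose b' := Num.max b 0; have b'0 : 0 <= b' by rewrite le_max lexx orbT.
have bb' : b <= b' by rewrite le_max lexx.
(* The term [c * M'] absorbs [c |x|] on the ball, where [-b] is the bound; outside, the nonnegative
   offset only weakens [c |x| <= f x]. *)
exists c, (b' + c * M'); split => // x; have [xM|Mx] := leP (enorm x) M'.
  by apply: le_trans (Kb _ (MK _ xM)); rewrite lee_fin; nra.
have x0 : 0 < enorm x by exact: le_lt_trans Mx.
have Vx : V x by apply: MV => /=; apply: le_lt_trans Mx; rewrite le_max lexx.
have : (c%:E <= f x * ((enorm x)^-1)%:E)%E.
  rewrite -leeN2; apply: le_trans sc; apply: ereal_sup_ubound.
  by exists x.
rewrite lee_pdivlMr// -EFinM; apply: le_trans.
by rewrite lee_fin; nra.
Qed.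

(** * Lower bounds near a point for small [mu] *)

(* A point [w] is either within [e] of [x], where [f] exceeds [r], or so far
   from [z] that the quadratic penalty alone makes up for [r - b]. *)
Lemma moreau_env_near_ge (R : realType) (n : nat) (f : 'rV[R]_n -> \bar R)
    (b r : R) (x : 'rV[R]_n) :
  lower_semicontinuous f -> (forall w, b%:E <= f w)%E -> (r%:E < f x)%E ->
  \forall z \near x & mu \near 0^'+, (r%:E <= moreau_env mu f z)%E.
Proof.
move=> f_lsc fb rf; have [V /nbhs_ballP[e/= e0 eV] Vf] := f_lsc _ _ rf.
(* For [mu] below this threshold the penalty at distance [e / 2] exceeds [|r - b|]; the [+ 1] keeps
   the denominator positive. *)
have d0 : 0 < (e / 2) ^+ 2 / (2 * (`|r - b| + 1)).
  by rewrite divr_gt0 ?exprn_gt0 ?mulr_gt0 ?divr_gt0// ltr_wpDl.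
near=> z mu => /=.
have mu0 : 0 < mu by near: mu; exact: nbhs_right_gt.
apply: le_moreau_env => w; have [xw|xw] := ltP `|x - w| e.
  rewrite -[leLHS]adde0; apply: leeD; last first.
    by rewrite lee_fin mulr_ge0 ?sqr_ge0// invr_ge0 mulr_ge0// ltW.
  by apply/ltW/Vf/eV; rewrite mx_norm_ball.
have xz : `|x - z| < e / 2.
  near: z; apply/nbhs_ballP; exists (e / 2) => /=; first by rewrite divr_gt0.
  by move=> y; rewrite mx_norm_ball.
have zw : e / 2 <= enorm (w - z).
  have : e / 2 <= `|w - z|.
    by have := ler_distD z x w; rewrite (distrC z w); lra.
  (* Neighbourhoods are measured in the sup norm, which [enorm] dominates. *)
  move/le_trans; apply; rewrite [leLHS]mx_normrE.
  apply: bigmax_le => [|[i j] _]; first exact: enorm_ge0.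
  by rewrite ord1; exact: ler_coord_enorm.
have mud : mu < (e / 2) ^+ 2 / (2 * (`|r - b| + 1)).
  by near: mu; exact: nbhs_right_lt.
apply: le_trans (leeD2r _ (fb w)); rewrite -EFinD lee_fin -lerBlDl.
apply: le_trans (ler_norm _) _.
rewrite mulrC ler_pdivlMr ?mulr_gt0//.
have ew : (e / 2) ^+ 2 <= enorm (w - z) ^+ 2.
  by rewrite ler_sqr ?nnegrE ?enorm_ge0// ltW// divr_gt0.
apply: le_trans ew; move: mud; rewrite ltr_pdivlMr; last first.
  by rewrite mulr_gt0// ltr_wpDl.
have := normr_ge0 (r - b); nra.
Unshelve. all: by end_near. Qed.

(** For [p > 0] a large [A] makes up for any [B]; for [p = 0], the convention [0 * +oo = 0] and
    [q = 1] allow [B = r]. *)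
Lemma convex_comb_pinfty_split (R : realType) (p q r : R) (v : \bar R) :
  0 <= p -> p + q = 1 -> v != -oo%E -> (r%:E < p%:E * +oo + q%:E * v)%E ->
  exists A B : R, (B%:E < v)%E /\ r <= p * A + q * B.
Proof.
rewrite le_eqVlt => /predU1P[<-|p0] pq vNy.
  move: pq; rewrite add0r => ->; rewrite mul0e add0e mul1e => rv.
  by exists 0, r; split => //; lra.
move=> _; have [B Bv] := exists_EFin_lt vNy.
exists ((r - q * B) / p), B; split => //.
by rewrite mulrC divfK ?gt_eqF//; lra.
Qed.

(** This lets lower semicontinuity be applied to [f] and [g] separately, even at infinite values. *)
Lemma convex_comb_split (R : realType) (p q r : R) (u v : \bar R) :
  0 <= p -> 0 <= q -> p + q = 1 -> u != -oo%E -> v != -oo%E ->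
  (r%:E < p%:E * u + q%:E * v)%E ->
  exists A B : R, [/\ (A%:E < u)%E, (B%:E < v)%E & r <= p * A + q * B].
Proof.
move=> p0 q0 pq uNy vNy.
case: u uNy => [u _|_|//]; last first.
  move=> /(convex_comb_pinfty_split p0 pq vNy)[A [B [Bv rAB]]].
  by exists A, B; split => //; exact: ltry.
case: v vNy => [v _|_|//]; last first.
  rewrite addrC in pq; rewrite addeC => rv.
  have uNy : u%:E != -oo%E by [].
  have [A [B [Bu rAB]]] := convex_comb_pinfty_split q0 pq uNy rv.
  by exists B, A; split => //; [exact: ltry|rewrite addrC].
rewrite -!EFinM -EFinD lte_fin => ruv.
(* Both values are lowered by the same positive slack; as the weights sum to [1], the combination
   drops exactly to [r]. *)
exists (u - (p * u + q * v - r)), (v - (p * u + q * v - r)).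
rewrite !lte_fin; split; [lra|lra|].
set s := p * u + q * v - r.
have -> : p * (u - s) + q * (v - s) = p * u + q * v - (p + q) * s by ring.
by rewrite pq /s; lra.
Qed.

Lemma phi_near_ge (R : realType) (n : nat) (a : R) (f g : 'rV[R]_n -> \bar R)
    (b r : R) (x : 'rV[R]_n) :
  0 <= a -> a <= 1 -> lower_semicontinuous f -> lower_semicontinuous g ->
  (forall w, b%:E <= f w)%E -> (forall w, b%:E <= g w)%E ->
  (r%:E < convex_comb a f g x)%E ->
  \forall z \near x & mu \near 0^'+, (r%:E <= phi a f g mu z)%E.
Proof.
move=> a0 a1 f_lsc g_lsc fb gb.
have hNy (h : 'rV[R]_n -> \bar R) : (forall w, b%:E <= h w)%E -> h x != -oo%E.
  by move=> hb; rewrite -ltNye (lt_le_trans _ (hb x))// ltNyr.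
have a1' : 0 <= 1 - a by rewrite subr_ge0.
move=> /(convex_comb_split a0 a1' (subrKC _ _) (hNy _ fb) (hNy _ gb)).
move=> [A [B [Af Bg rAB]]].
have nf := moreau_env_near_ge f_lsc fb Af.
apply: filterS2 nf (moreau_env_near_ge g_lsc gb Bg).
move=> [z mu]/= fA gB; apply: le_trans (phi_ge z a0 a1 fA gB).
rewrite subrr lee_fin /enorm big1 ?sqrtr0 ?expr0n/= ?mulr0 ?subr0//.
by move=> i _; rewrite mxE expr0n.
Qed.

(** * Infima and minimisers as [mu] decreases to [0] *)

Lemma inff_phi_near_ge (R : realType) (n : nat) (a : R)
    (f g : 'rV[R]_n -> \bar R) (b c r : R) :
  0 <= a -> a <= 1 -> lower_semicontinuous f -> lower_semicontinuous g ->
  0 < c -> (forall w, (c * enorm w - b)%:E <= f w)%E ->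
  (forall w, (c * enorm w - b)%:E <= g w)%E ->
  (r%:E < inff (convex_comb a f g))%E ->
  \forall mu \near 0^'+, (r%:E <= inff (phi a f g mu))%E.
Proof.
move=> a0 a1 f_lsc g_lsc c0 fc gc rF.
have lb (h : 'rV[R]_n -> \bar R) :
    (forall w, (c * enorm w - b)%:E <= h w)%E -> forall w, ((- b)%:E <= h w)%E.
  move=> hc w; apply: le_trans (hc w).
  by rewrite lee_fin lerDr mulr_ge0 ?enorm_ge0// ltW.
(* Beyond the radius [(r + b) / c] the minorant alone reaches [r] for every [mu]; on [K] the local
   bounds merge into one range of [mu]. *)
have [K /compact_near_coveringP cK MK] := enorm_ball_compact n ((r + b) / c).
have : \forall mu \near 0^'+, K `<=` [set x | (r%:E <= phi a f g mu x)%E].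
  apply: cK => x Kx; apply: (phi_near_ge a0 a1 f_lsc g_lsc (lb _ fc) (lb _ gc)).
  by apply: lt_le_trans rF _; apply: ereal_inf_lbound; exists x.
move=> H; near=> mu.
have mu0 : 0 < mu by near: mu; exact: nbhs_right_gt.
have Kphi : K `<=` [set x | (r%:E <= phi a f g mu x)%E] by near: mu.
apply: le_ereal_inf_tmp => _ [x _ <-].
have [xM|Mx] := leP (enorm x) ((r + b) / c); first exact/Kphi/MK.
apply: le_trans (phi_ge_minorant x a0 a1 mu0 (ltW c0) fc gc).
rewrite lee_fin lerBrDr mulrC -ler_pdivrMr//; exact: ltW.
Unshelve. all: by end_near. Qed.

Theorem theorem7p12 (R : realType) (n : nat) (f g : 'rV[R]_n -> \bar R)
    (a : R)
    (f_proper : proper_fun f) (g_proper : proper_fun g)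
    (f_lsc : lower_semicontinuous f) (g_lsc : lower_semicontinuous g)
    (f_coercive : level_coercive f) (g_coercive : level_coercive g)
    (dom_fg : eff_dom f `&` eff_dom g !=set0)
    (a_ge0 : 0 <= a) (a_le1 : a <= 1) :
  [/\ inff (phi a f g mu) @[mu --> 0^'+] --> inff (convex_comb a f g),
      outer_limit (fun mu => argmin (phi a f g mu))
        `<=` argmin (convex_comb a f g)
    & exists M : R, forall (mu : R) (x : 'rV[R]_n),
        0 < mu -> argmin (phi a f g mu) x -> enorm x <= M].
Proof.
have [cf [bf [cf0 fm]]] := level_coercive_minorant f_proper f_lsc f_coercive.
have [cg [bg [cg0 gm]]] := level_coercive_minorant g_proper g_lsc g_coercive.
(* The smaller slope and the larger offset give a common minorant. *)
pose c := Num.min cf cg; pose b := Num.max bf bg.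
have c0 : 0 < c by rewrite lt_min cf0.
have cbE (c' b' : R) (w : 'rV[R]_n) : c <= c' -> b' <= b ->
    ((c * enorm w - b)%:E <= (c' * enorm w - b')%:E)%E.
  by move=> cc' bb'; rewrite lee_fin lerB// ler_wpM2r ?enorm_ge0.
have fc w : ((c * enorm w - b)%:E <= f w)%E.
  by apply: le_trans (fm w); apply: cbE; rewrite ?ge_min ?le_max lexx.
have gc w : ((c * enorm w - b)%:E <= g w)%E.
  by apply: le_trans (gm w); apply: cbE; rewrite ?ge_min ?le_max lexx ?orbT.
have lb (h : 'rV[R]_n -> \bar R) :
    (forall w, (c * enorm w - b)%:E <= h w)%E -> forall w, ((- b)%:E <= h w)%E.
  move=> hc w; apply: le_trans (hc w).
  by rewrite lee_fin lerDr mulr_ge0 ?enorm_ge0// ltW.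
have phi_lb mu x : 0 < mu -> ((c * enorm x - b)%:E <= phi a f g mu x)%E.
  by move=> mu0; apply: phi_ge_minorant => //; exact: ltW.
have phi_ub mu x : 0 < mu -> (phi a f g mu x <= convex_comb a f g x)%E.
  move=> mu0; apply: (phi_le x a_ge0 a_le1 mu0 _ _ (lb _ fc) (lb _ gc)).
    exact: f_proper.2.
  exact: g_proper.2.
have inf_phi_lb mu : 0 < mu -> ((- b)%:E <= inff (phi a f g mu))%E.
  move=> mu0; apply: le_ereal_inf_tmp => _ [x _ <-].
  by apply: lb => w; exact: phi_lb.
have inf_phi_ub mu : 0 < mu ->
    (inff (phi a f g mu) <= inff (convex_comb a f g))%E.
  move=> mu0; apply: le_ereal_inf_tmp => _ [x _ <-].
  by apply: le_trans (phi_ub mu x mu0); apply: ereal_inf_lbound; exists x.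
(* Finite: the minorant bounds it below (through [mu = 1]), a common point of the domains above. *)
have [L LE] : exists L : R, inff (convex_comb a f g) = L%:E.
  suff /fineK <- : inff (convex_comb a f g) \is a fin_num by eexists.
  rewrite fin_numElt; apply/andP; split.
    have := le_trans (inf_phi_lb _ ltr01) (inf_phi_ub _ ltr01).
    exact: lt_le_trans (ltNyr _).
  have [x0 [fx0 gx0]] := dom_fg.
  apply: (@le_lt_trans _ _ (convex_comb a f g x0)).
    by apply: ereal_inf_lbound; exists x0.
  have fin (h : 'rV[R]_n -> \bar R) : (forall w, ((- b)%:E <= h w)%E) ->
      (h x0 < +oo)%E -> h x0 \is a fin_num.
    by move=> hb hx; rewrite fin_numElt hx (lt_le_trans _ (hb x0))// ltNyr.
  by rewrite ltey_eq fin_numD !fin_numM// fin//; exact: lb.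
rewrite LE in inf_phi_ub *.
split.
- apply/fine_cvgP; split.
    near=> mu; have mu0 : 0 < mu by near: mu; exact: nbhs_right_gt.
    rewrite fin_numElt (lt_le_trans _ (inf_phi_lb _ mu0)) ?ltNyr//.
    by rewrite (le_lt_trans (inf_phi_ub _ mu0))// ltry.
  apply/cvgrPdist_le => e e0; near=> mu => /=.
  have mu0 : 0 < mu by near: mu; exact: nbhs_right_gt.
  have : ((L - e)%:E <= inff (phi a f g mu))%E.
    near: mu; apply: (inff_phi_near_ge a_ge0 a_le1 f_lsc g_lsc c0 fc gc).
    by rewrite LE lte_fin ltrBlDr ltrDl.
  move: (inf_phi_ub _ mu0); case: inff => [s| |]//.
  by rewrite !lee_fin /= => sL Ls; rewrite ger0_norm; lra.
- move=> x [mu_ [x_ [mu_0 mu_gt0 x_min xcl]]].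
  rewrite /argmin/= LE; apply/eqP; rewrite eq_le andbC; apply/andP; split.
    by rewrite -LE; apply: ereal_inf_lbound; exists x.
  rewrite leNgt; apply/negP => Lx.
  (* A level strictly between [L] and the value at [x], which may be [+oo]. *)
  have [r Lr rx] : exists2 r : R, L < r & (r%:E < convex_comb a f g x)%E.
    move: Lx; case: convex_comb => [s|_|//].
      rewrite lte_fin => Ls; exists ((L + s) / 2); rewrite ?lte_fin; lra.
    by exists (L + 1); rewrite ?ltry//; lra.
  have [[U N]/= [Ux N0] UN] :=
    phi_near_ge a_ge0 a_le1 f_lsc g_lsc (lb _ fc) (lb _ gc) rx.
  (* The cluster point [x] forces a term of the tail, where [mu_ k] is small, into [U]; there
     [r <= phi = inff phi <= L < r]. *)
  have [_ [[k Nk <-] Uxk]] : [set x_ k | k in [set k | N (mu_ k)]] `&` U !=set0.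
    have Nmu : \forall k \near \oo, N (mu_ k) by exact: mu_0.
    by apply: xcl => //; apply: filterS Nmu => k Nk; exists k.
  have := UN (x_ k, mu_ k) (conj Uxk Nk).
  rewrite /= x_min => /le_trans/(_ (inf_phi_ub _ (mu_gt0 k))).
  by rewrite lee_fin leNgt Lr.
(* At a minimiser, [c |x| - b <= phi = inff phi <= L], whatever [mu]. *)
- exists ((L + b) / c) => mu x mu0 xmin.
  have := phi_lb mu x mu0; rewrite xmin => /le_trans/(_ (inf_phi_ub _ mu0)).
  by rewrite lee_fin lerBlDr ler_pdivlMr// mulrC.
Unshelve. all: by end_near. Qed.
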